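(* Let $N=[n]$ and let $(N\cup\{i\}, G, f^{\leq\kappa})$ be a social network under the all-but-$\kappa$ protocol with $\kappa\geq 0$. If $G_i$ is the influencer set of agent $i$, then there exists a Consistent Hypothesis Finder that, for any labelling sample of size $m$ (together with the oracle predictions for agent $i$), finds a feasible influencer set $F\subseteq N$ in $\mathcal{O}(m\,n^{|G_i|+1})$ time.
   Context: $N=[n]=\{1,\dots,n\}$ is a finite set of agents and $i$ is an additional distinguished target agent. $G$ is a directed graph on $N\cup\{i\}$; $G_i=\{j\in N: j\to i \text{ in } G\}$ is the (unknown) influencer set of $i$. A network labelling is a function $\ell:N\to L$ with $L=\{\phi,\neg\phi\}$; $\ell(j)=\phi$ means that $j$ agrees with agent $i$, and $\ell(j)=\neg\phi$ that $j$ disagrees with agent $i$. For an integer $\kappa\ge 0$, the all-but-$\kappa$ protocol is the boolean sentence, for $\ell\in L^N$ and $F\subseteq N$, $$f^{\leq\kappa}(\ell,F):\quad \sum_{j\in F}\mathbf 1(\ell(j)=\phi)\leq\kappa,$$ which is True if agent $i$ (with influencers $F$) changes opinion and False otherwise. The learner knows the protocol (including $\kappa$). A labelling sample of size $m$ is a sequence $\ell_1,\dots,\ell_m\in L^N$ together with the oracle predictions (truth values) $f(\ell_k,G_i)$, $k=1,\dots,m$. A set $F\subseteq N$ is a feasible influencer set for the sample if $f(\ell_k,F)=f(\ell_k,G_i)$ for all $k=1,\dots,m$. A Consistent Hypothesis Finder (CHF) is an algorithm that, for every $m>0$, every $G_i\subseteq N$ and every labelling sample of size $m$ generated with $G_i$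 (the algorithm sees the labellings and predictions, not $G_i$), outputs a feasible influencer set $F\subseteq N$ for the sample. *)

(* Defs.v *)
From mathcomp Require Import all_boot.

Set Implicit Arguments.
Unset Strict Implicit.
Unset Printing Implicit Defensive.

(** * Networks, protocol, samples *)

(* The agent j of N = [n] is the ordinal j - 1 : 'I_n. *)

(* L = {phi, ~phi} *)
Definition label := bool.
Definition phi : label := true.

Definition labelling (n : nat) := {ffun 'I_n -> label}.

(* A directed graph on N + {i}: [None] is the target agent i, and [G u v] means
   u -> v. *)
Definition network (n : nat) := rel (option 'I_n).

Definition influencers (n : nat) (G : network n) : {set 'I_n} :=
  [set j | G (Some j) None].

Definition all_but (kappa n : nat) (l : labelling n) (F : {set 'I_n}) : bool :=
  \sum_(j in F) (l j == phi) <= kappa.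

Definition oracle (kappa n m : nat) (ls : m.-tuple (labelling n))
    (Gi : {set 'I_n}) : m.-tuple bool :=
  [tuple of [seq all_but kappa l Gi | l <- ls]].

Definition feasible (kappa n m : nat) (ls : m.-tuple (labelling n))
    (Gi F : {set 'I_n}) : Prop :=
  forall k : 'I_m,
    all_but kappa (tnth ls k) F = all_but kappa (tnth ls k) Gi.

(** * Model of computation

   A unit-cost random access machine, presented as a structured language.  A
   program uses finitely many registers and finitely many arrays, indexed by
   natural numbers.  The only arithmetic is addition and truncated subtraction:
   with unit-cost multiplication, numbers of exponential length could be
   manufactured, and computed on, in linear time. *)

Inductive program : Type :=
| Skip
| Const (x k : nat)           (* x := k *)
| Add (x y z : nat)           (* x := y + z *)
| Sub (x y z : nat)           (* x := y - z, truncated *)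
| Read (x a y : nat)          (* x := a[y] *)
| Write (a y x : nat)         (* a[y] := x *)
| Seq (p q : program)
| If (x : nat) (p q : program)   (* tests x != 0 *)
| While (x : nat) (p : program). (* tests x != 0 *)

Record state := State { reg : nat -> nat; arr : nat -> nat -> nat }.

Definition set_reg (s : state) (x v : nat) : state :=
  State (fun y => if y == x then v else reg s y) (arr s).

Definition set_arr (s : state) (a i v : nat) : state :=
  State (reg s) (fun b j => if (b == a) && (j == i) then v else arr s b j).

(* [exec p s t s']: started in s, p halts in s' after t time units; every
   elementary instruction and every evaluation of a test takes one unit. *)
Inductive exec : program -> state -> nat -> state -> Prop :=
| ExecSkip s : exec Skip s 1 s
| ExecConst s x k : exec (Const x k) s 1 (set_reg s x k)
| ExecAdd s x y z : exec (Add x y z) s 1 (set_reg s x (reg s y + reg s z))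
| ExecSub s x y z : exec (Sub x y z) s 1 (set_reg s x (reg s y - reg s z))
| ExecRead s x a y : exec (Read x a y) s 1 (set_reg s x (arr s a (reg s y)))
| ExecWrite s a y x : exec (Write a y x) s 1 (set_arr s a (reg s y) (reg s x))
| ExecSeq p q s t1 s1 t2 s2 :
    exec p s t1 s1 -> exec q s1 t2 s2 -> exec (Seq p q) s (t1 + t2) s2
| ExecIfT x p q s t s' :
    reg s x != 0 -> exec p s t s' -> exec (If x p q) s t.+1 s'
| ExecIfF x p q s t s' :
    reg s x = 0 -> exec q s t s' -> exec (If x p q) s t.+1 s'
| ExecWhileT x p s t1 s1 t2 s2 :
    reg s x != 0 -> exec p s t1 s1 -> exec (While x p) s1 t2 s2 ->
    exec (While x p) s (t1 + t2).+1 s2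
| ExecWhileF x p s : reg s x = 0 -> exec (While x p) s 1 s.

Lemma exec_det p s t1 s1 t2 s2 :
  exec p s t1 s1 -> exec p s t2 s2 -> t1 = t2 /\ s1 = s2.
Proof.
move=> H; elim: H t2 s2 => {p s t1 s1}; intros;
  match goal with H : exec _ _ ?t ?s |- _ = ?t /\ _ = ?s => inversion H; subst end;
  repeat match goal with
  | nz : is_true (reg ?s ?x != 0), z : reg ?s ?x = 0 |- _ => by rewrite z in nz
  | IH : forall t s, exec ?p ?s0 t s -> _ /\ _, E : exec ?p ?s0 _ _ |- _ =>
      case: (IH _ _ E) => ? ?; subst; clear IH
  end; by [].
Qed.

(** * Consistent hypothesis finders *)

(* Input convention: registers 0, 1, 2 hold n, m, kappa; array 0 holds the
   labellings in row-major order (the label of agent j under the k-th labelling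
   is at index k * n + j), array 1 the predictions; everything else is 0. *)
Definition input (kappa n m : nat) (ls : m.-tuple (labelling n))
    (ys : m.-tuple bool) : state :=
  State
    (fun x => nth 0 [:: n; m; kappa] x)
    (fun a => nth 0 (nth [::]
       [:: flatten [seq [seq nat_of_bool (l j == phi) | j <- enum 'I_n]
                  | l : labelling n <- ls];
           [seq nat_of_bool y | y <- ys]] a)).

(* The output is read off the first n cells of array 2, as the indicator
   function of F. *)
Definition outputs_in (A : program) (kappa n m : nat)
    (ls : m.-tuple (labelling n)) (ys : m.-tuple bool)
    (t : nat) (F : {set 'I_n}) : Prop :=
  exists2 s : state, exec A (input kappa ls ys) t s
    & forall j : 'I_n, arr s 2 j = (j \in F).

Definition CHF (kappa n : nat) (A : program) : Prop :=
  forall (m : nat) (Gi : {set 'I_n}) (ls : m.-tuple (labelling n)),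
    0 < m ->
    exists t F, outputs_in A kappa ls (oracle kappa ls Gi) t F
                /\ feasible kappa ls Gi F.

(* Main.v *)
Require Import Defs.
From mathcomp Require Import all_boot.
From mathcomp Require Import zify.
(* So that [Sub] is the instruction, not the subtype constructor of eqtype. *)
Import Defs.

(** A subset of [n] is encoded by any string over the digits 1, ..., n listing
    its elements, with repetitions allowed.  The strings are exactly the
    bijective base-n numerals (0 being the empty string), so incrementing a
    counter from 0 runs through all of them by nondecreasing length.  The finder
    tests the subset of each string against the sample, in time O(m n), and
    stops at the first feasible one.  For n > 0, a string listing G_i without
    repetition has length |G_i| and value less than 2 n^|G_i|, so the search
    stops after O(n^|G_i|) tests. *)

Set Implicit Arguments.
Unset Strict Implicit.
Unset Printing Implicit Defensive.

(** * Time-bounded total correctness of machine programs *)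

Definition runs (p : program) (s : state) (T : nat) (Q : state -> Prop) : Prop :=
  exists t s', [/\ exec p s t s', t <= T & Q s'].

Lemma runs_weaken p s T T' (Q Q' : state -> Prop) :
  runs p s T Q -> T <= T' -> (forall s', Q s' -> Q' s') -> runs p s T' Q'.
Proof.
by move=> [t [s' [E tT q]]] TT' QQ'; exists t, s'; split=> //;
  [exact: leq_trans TT' | exact: QQ'].
Qed.

Lemma runs_seq p q s T1 T2 (Q : state -> Prop) :
  runs p s T1 (fun s1 => runs q s1 T2 Q) -> runs (Seq p q) s (T1 + T2) Q.
Proof.
move=> [t1 [s1 [E1 l1 [t2 [s2 [E2 l2 q2]]]]]].
by exists (t1 + t2), s2; split=> //; [exact: ExecSeq E1 E2 | exact: leq_add].
Qed.

Fixpoint straight (p : program) : bool :=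
  match p with
  | Seq p q | If _ p q => straight p && straight q
  | While _ _ => false
  | _ => true
  end.

Fixpoint cost (p : program) : nat :=
  match p with
  | Seq p q => cost p + cost q
  | If _ p q => (cost p + cost q).+1
  | _ => 1
  end.

(* Loops are given a junk effect: [effect] is meaningful on straight programs. *)
Fixpoint effect (p : program) (s : state) : state :=
  match p with
  | Const x k => set_reg s x k
  | Add x y z => set_reg s x (reg s y + reg s z)
  | Sub x y z => set_reg s x (reg s y - reg s z)
  | Read x a y => set_reg s x (arr s a (reg s y))
  | Write a y x => set_arr s a (reg s y) (reg s x)
  | Seq p q => effect q (effect p s)
  | If x p q => if reg s x != 0 then effect p s else effect q s
  | Skip | While _ _ => s
  end.

(** Loop-free code is run symbolically: the goal becomes a computation of [effect]. [cost] adds up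
    both branches of a conditional, so it only overestimates the time. *)
Lemma runs_straight p s (Q : state -> Prop) :
  straight p -> Q (effect p s) -> runs p s (cost p) Q.
Proof.
move=> st q; suff [t E lt] : exists2 t, exec p s t (effect p s) & t <= cost p
  by exists t, (effect p s).
elim: p s st {q} => /=
    [||||||p IHp q IHq|x p IHp q IHq|//];
  try by move=> *; eexists; first by constructor.
- move=> s0 /andP[sp sq].
  have [t1 E1 l1] := IHp s0 sp; have [t2 E2 l2] := IHq (effect p s0) sq.
  by exists (t1 + t2); [exact: ExecSeq E1 E2 | exact: leq_add].
- move=> s0 /andP[sp sq].
  have [t1 E1 l1] := IHp s0 sp; have [t2 E2 l2] := IHq s0 sq.
  case: eqP => /= [z|/eqP nz].
  + by exists t2.+1; [exact: ExecIfF | lia].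
  + by exists t1.+1; [exact: ExecIfT | lia].
Qed.

(** The invariant is indexed by the number of completed passes, and termination comes from it: a
    pass can only start at some [k < N]. Each pass pays one unit for its test, and the last unit
    pays for the failing test. *)
Lemma runs_while x p T N (I : nat -> state -> Prop) s :
  (forall k s', I k s' -> reg s' x != 0 -> k < N /\ runs p s' T (I k.+1)) ->
  I 0 s ->
  runs (While x p) s (N * T.+1).+1
    (fun s' => reg s' x = 0 /\ exists2 k, k <= N & I k s').
Proof.
move=> step I0.
suff go r k s' : r = N - k -> k <= N -> I k s' ->
    runs (While x p) s' (r * T.+1).+1
      (fun s' => reg s' x = 0 /\ exists2 k, k <= N & I k s').
  by apply: (go N 0 s); rewrite ?subn0.
elim: r k s' => [|r IHr] k s' rE kN Ik;
  case: (eqVneq (reg s' x) 0) => [z|nz].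
- by exists 1, s'; split=> //; [exact: ExecWhileF | split=> //; exists k].
- by have [] := step _ _ Ik nz; lia.
- by exists 1, s'; split=> //; [exact: ExecWhileF | split=> //; exists k].
- have [kltN [t1 [s1 [E1 l1 I1]]]] := step _ _ Ik nz.
  have [|t2 [s2 [E2 l2 Q2]]] := IHr k.+1 s1 _ kltN I1; first by lia.
  by exists (t1 + t2).+1, s2; split=> //; [exact: ExecWhileT E1 E2 | lia].
Qed.

Lemma runs_countdown x p T N (I : nat -> state -> Prop) s :
  (forall k s', k < N -> reg s' x = N - k -> I k s' ->
     runs p s' T (fun s1 => reg s1 x = N - k.+1 /\ I k.+1 s1)) ->
  reg s x = N -> I 0 s -> runs (While x p) s (N * T.+1).+1 (I N).
Proof.
move=> step xN I0.
(* The truncated [N - k] also vanishes for [k > N]; carrying [k <= N] along makes the exit test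
   yield [k = N]. *)
have step' k s' : (k <= N /\ (reg s' x = N - k /\ I k s')) -> reg s' x != 0 ->
    k < N /\ runs p s' T (fun s1 => k.+1 <= N /\ (reg s1 x = N - k.+1 /\ I k.+1 s1)).
  move=> [kN [xk Ik]] nz; have kltN : k < N by lia.
  by split=> //; apply: runs_weaken (step _ _ kltN xk Ik) (leqnn _) _.
have := runs_while (I := fun k s' => k <= N /\ (reg s' x = N - k /\ I k s')) step'.
move=> /(_ s) [|t [s' [E l [z [k kN [_ [xk Ik]]]]]]]; first by rewrite subn0.
by exists t, s'; split=> //; have <- : k = N by lia.
Qed.

(** * Syntactic frame conditions *)

Fixpoint keeps_reg (x : nat) (p : program) : bool :=
  match p with
  | Const y _ | Add y _ _ | Sub y _ _ | Read y _ _ => x != y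
  | Seq p q | If _ p q => keeps_reg x p && keeps_reg x q
  | While _ p => keeps_reg x p
  | Skip | Write _ _ _ => true
  end.

Fixpoint keeps_arr (a : nat) (p : program) : bool :=
  match p with
  | Write b _ _ => a != b
  | Seq p q | If _ p q => keeps_arr a p && keeps_arr a q
  | While _ p => keeps_arr a p
  | _ => true
  end.

Definition frame (p : program) (s s' : state) : Prop :=
  (forall x, keeps_reg x p -> reg s' x = reg s x) /\
  (forall a, keeps_arr a p -> forall i, arr s' a i = arr s a i).

Lemma exec_frame p s t s' : exec p s t s' -> frame p s s'.
Proof.
elim=> {p s t s'} //=.
- by move=> s x k; split=> //= y /negPf->.
- by move=> s x y z; split=> //= u /negPf->.
- by move=> s x y z; split=> //= u /negPf->.
- by move=> s x a y; split=> //= u /negPf->.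
- by move=> s a y x; split=> //= b /negPf->.
- move=> p q s t1 s1 t2 s2 _ [r1 a1] _ [r2 a2]; split=> [x|a] /= /andP[kp kq].
    by rewrite r2 ?r1.
  by move=> i; rewrite a2 ?a1.
- by move=> x p q s t s' _ _ [r a]; split=> [y|b] /= /andP[kp kq];
    [exact: r | exact: a].
- by move=> x p q s t s' _ _ [r a]; split=> [y|b] /= /andP[kp kq];
    [exact: r | exact: a].
- move=> x p s t1 s1 t2 s2 _ _ [r1 a1] _ [r2 a2]; split=> [y|a] /= k.
    by rewrite r2 ?r1.
  by move=> i; rewrite a2 ?a1.
Qed.

(** Lets the specification of a subroutine omit everything that its code never assigns. *)
Lemma runs_frame p s T (Q : state -> Prop) :
  runs p s T Q -> runs p s T (fun s' => Q s' /\ frame p s s').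
Proof.
by move=> [t [s' [E l q]]]; exists t, s'; split=> //; split=> //; exact: exec_frame E.
Qed.

(** * The program of the finder *)

(* Registers 3 and 4 hold the constants 0 and 1.  Array 3 holds the current
   string, least significant digit first and terminated by 0; register 11 counts
   the labellings of the sample on which its subset fails. *)
Definition clear : program :=
  Seq (Add 5 0 3) (While 5 (Seq (Sub 5 5 4) (Write 2 5 3))).

Definition mark : program :=
  Seq (Seq (Const 13 0) (Read 7 3 13))
      (While 7 (Seq (Sub 7 7 4) (Seq (Write 2 7 4)
               (Seq (Add 13 13 4) (Read 7 3 13))))).

Definition count_row : program :=
  Seq (Seq (Const 9 0) (Add 5 0 3))
      (While 5 (Seq (Read 7 0 8)
               (Seq (If 7 (Seq (Sub 6 0 5) (Seq (Read 7 2 6) (Add 9 9 7))) Skip)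
               (Seq (Add 8 8 4) (Sub 5 5 4))))).

Definition compare_row : program :=
  Seq (Sub 12 9 2) (Seq (Sub 7 1 10) (Seq (Read 7 1 7)
  (Seq (If 12 (Add 11 11 7) (Seq (Sub 7 4 7) (Add 11 11 7)))
       (Sub 10 10 4)))).

Definition evaluate : program :=
  Seq (Seq (Const 11 0) (Seq (Const 8 0) (Add 10 1 3)))
      (While 10 (Seq count_row compare_row)).

(* Register 12 is nonzero iff the digit at position [reg 13] equals n, that is,
   iff the carry propagates.  Past the end of the string the digit read is 0,
   which the final addition turns into a new leading 1. *)
Definition increment : program :=
  Seq (Seq (Seq (Const 13 0) (Seq (Read 7 3 13) (Seq (Sub 12 0 7) (Sub 12 4 12))))
      (While 12 (Seq (Write 3 13 4) (Seq (Add 13 13 4)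
                (Seq (Read 7 3 13) (Seq (Sub 12 0 7) (Sub 12 4 12)))))))
      (Seq (Add 7 7 4) (Write 3 13 7)).

Definition trial : program := Seq clear (Seq mark evaluate).

Definition finder : program :=
  Seq (Const 4 1) (Seq trial (While 11 (Seq increment trial))).

(** * Testing the subset of one string *)

Lemma clear_runs s n : reg s 0 = n -> reg s 3 = 0 -> reg s 4 = 1 ->
  runs clear s (n * 3 + 2) (fun s' => forall j, j < n -> arr s' 2 j = 0).
Proof.
move=> r0 r3 r4; rewrite addnC -[2 + _]/(1 + (n * 3).+1).
apply: runs_seq; apply: runs_straight => //=.
have := @runs_countdown 5 (Seq (Sub 5 5 4) (Write 2 5 3)) 2 n
  (fun k s' => [/\ reg s' 3 = 0, reg s' 4 = 1 &
               forall j, n - k <= j < n -> arr s' 2 j = 0]).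
move=> /(_ (set_reg s 5 (reg s 0 + reg s 3))) H.
apply: (runs_weaken (H _ _ _) (leqnn _)).
- move=> k s' kn xk [h3 h4 hj]; apply: runs_straight => //=.
  rewrite h4 xk; split; first by lia.
  split=> // j jk; case: eqP => [//|ne]; apply: hj; lia.
- by rewrite /= r0 r3 addn0.
- by split=> //= j; lia.
- by move=> s' [_ _ hj] j jn; apply: hj; lia.
Qed.

Definition digits (n : nat) (w : seq nat) : bool := all (fun d => 0 < d <= n) w.

Definition stores (w : seq nat) (s : state) : Prop :=
  forall i, arr s 3 i = nth 0 w i.

Lemma mark_runs s n w : reg s 4 = 1 -> digits n w -> stores w s ->
  (forall j, j < n -> arr s 2 j = 0) ->
  runs mark s (size w * 5 + 3)
    (fun s' => forall j, j < n -> arr s' 2 j = (j.+1 \in w)).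
Proof.
move=> r4 dw sw z; rewrite addnC -[3 + _]/(2 + (size w * 5).+1).
apply: runs_seq; apply: runs_straight => //=.
set body := Seq (Sub 7 7 4) _.
have := @runs_while 7 body 4 (size w)
  (fun k s' => [/\ k <= size w, stores w s', reg s' 4 = 1,
     reg s' 13 = k /\ reg s' 7 = nth 0 w k &
     forall j, j < n -> arr s' 2 j = (j.+1 \in take k w)]).
set s0 := set_reg _ _ _ => /(_ s0) H.
apply: (runs_weaken (H _ _) (leqnn _)).
- move=> k s' [kw st h4 [h13 h7] h2] nz.
  have kltw : k < size w.
    by rewrite ltnNge; apply: contra nz => wk; rewrite h7 nth_default.
  split=> //; apply: runs_straight => //=; split=> //=.
    by rewrite h13 h4 addn1 st.
  move=> j jn; rewrite (take_nth 0) // mem_rcons inE -h7 h4 h2 //.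
  case: eqP => [->|ne]; first by rewrite subn1 prednK ?lt0n ?eqxx.
  by rewrite [_.+1 == _](_ : _ = false) //; apply/eqP; lia.
- by split=> //= j jn; rewrite z // take0.
(* The loop ends on reading 0. No digit is 0, so this is the default past the end of [w], and every
   digit has been marked. *)
- move=> s' [z7 [k kw [_ st _ [_ h7] h2]]] j jn.
  rewrite h2 // take_oversize // leqNgt; apply/negP => kltw.
  by have /allP/(_ _ (mem_nth 0 kltw)) := dw; rewrite -h7 z7.
Qed.

Definition row_count (s : state) (n k : nat) : nat :=
  \sum_(0 <= j < n) (if arr s 0 (k * n + j) != 0 then arr s 2 j else 0).

Lemma count_row_runs s n : reg s 0 = n -> reg s 3 = 0 -> reg s 4 = 1 ->
  forall k, reg s 8 = k * n ->
  runs count_row s (n * 9 + 3)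
    (fun s' => reg s' 9 = row_count s n k /\ reg s' 8 = k.+1 * n).
Proof.
move=> r0 r3 r4 k r8; rewrite addnC -[3 + _]/(2 + (n * 9).+1).
apply: runs_seq; apply: runs_straight => //.
set body := Seq (Read 7 0 8) _.
have := @runs_countdown 5 body 8 n
  (fun i s' => [/\ reg s' 0 = n /\ reg s' 4 = 1, forall j, arr s' 0 j = arr s 0 j,
     forall j, arr s' 2 j = arr s 2 j, reg s' 8 = k * n + i &
     reg s' 9 = \sum_(0 <= j < i)
        (if arr s 0 (k * n + j) != 0 then arr s 2 j else 0)]).
set s0 := effect _ _ => /(_ s0) H.
apply: (runs_weaken (H _ _ _) (leqnn _)).
- move=> i s' iltn h5 [[h0 h4] ha0 ha2 h8 h9]; apply: runs_straight => //=.
  rewrite big_nat_recr //= -h9 ha0 h8.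
  case: ifP => hb /=; rewrite ?h0 ?h4 ?h5 ?h8 ?ha2;
    (split; [lia | split=> //; try lia]).
  by congr (_ + arr s 2 _); lia.
- by rewrite /= r0 r3 addn0.
- by split=> //=; rewrite ?big_nil // r8 addn0.
- by move=> s' [_ _ _ h8 h9]; split=> //; rewrite h8 mulSn addnC.
Qed.

(** Says that the term [compare_row] adds to register 11 vanishes: the prediction itself when the
    protocol is false on the subset, its complement when it is true. *)
Definition row_ok (kappa n : nat) (s : state) (k : nat) : bool :=
  if kappa < row_count s n k then arr s 1 k == 0 else 1 - arr s 1 k == 0.

(** Register 11 is a sum of natural numbers, one per row, hence zero exactly when every row
    contributes zero. *)
Lemma evaluate_runs s kappa n m :
  reg s 0 = n -> reg s 1 = m -> reg s 2 = kappa -> reg s 3 = 0 -> reg s 4 = 1 ->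
  runs evaluate s (m * (n * 9 + 12) + 4)
    (fun s' => (reg s' 11 == 0) = all (row_ok kappa n s) (iota 0 m)).
Proof.
move=> r0 r1 r2 r3 r4.
have -> : m * (n * 9 + 12) + 4 = 3 + (m * (n * 9 + 3 + 8).+1).+1 by lia.
apply: runs_seq; apply: runs_straight => //.
have := @runs_countdown 10 (Seq count_row compare_row) (n * 9 + 3 + 8) m
  (fun k s' => [/\ [/\ reg s' 0 = n, reg s' 1 = m, reg s' 2 = kappa,
                      reg s' 3 = 0 & reg s' 4 = 1],
     forall a, a < 3 -> forall i, arr s' a i = arr s a i, reg s' 8 = k * n &
     (reg s' 11 == 0) = all (row_ok kappa n s) (iota 0 k)]).
set s0 := effect _ _ => /(_ s0) H.
apply: (runs_weaken (H _ _ _) (leqnn _)).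
- move=> k s' km h10 [[h0 h1 h2 h3 h4] ha h8 h11].
  apply: runs_seq; apply: runs_weaken (runs_frame (count_row_runs h0 h3 h4 h8)) (leqnn _) _.
  move=> s1 [[e9 e8] [fr fa]]; apply: runs_straight => //.
  have cE : row_count s' n k = row_count s n k.
    by rewrite /row_count; apply: eq_bigr => j _; rewrite !ha.
  have {}ha a : a < 3 -> forall i, arr s1 a i = arr s a i.
    by move=> a3 i; rewrite fa ?ha //; case: a a3 => [|[|[|]]].
  have -> : iota 0 k.+1 = iota 0 k ++ [:: k] by rewrite -[k.+1]addn1 iotaD.
  rewrite all_cat -h11 /= e9 cE !fr // h1 h2 h10.
  have -> : m - (m - k) = k by lia.
  rewrite andbT /row_ok.
  rewrite -lt0n subn_gt0 ha //.
  case: ifP => c /=; rewrite ?e8 !fr // ?h0 ?h1 ?h2 ?h3 ?h4 ?h10 addn_eq0;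
    by split=> //; lia.
- by rewrite /= r1 r3 addn0.
- by split=> //=.
- by move=> s' [_ _ _].
Qed.

(** * Bijective base-n numerals *)

Fixpoint value (n : nat) (w : seq nat) : nat :=
  if w is d :: w' then d + n * value n w' else 0.

Fixpoint succ (n : nat) (w : seq nat) : seq nat :=
  if w is d :: w' then (if d == n then 1 :: succ n w' else d.+1 :: w') else [:: 1].

Lemma value_succ n w : value n (succ n w) = (value n w).+1.
Proof. by elim: w => [|d w IHw] /=; [lia | case: eqP => [->|_] /=; lia]. Qed.

Lemma digits_succ n w : 0 < n -> digits n w -> digits n (succ n w).
Proof.
move=> n0; elim: w => [|d w IHw]; first by rewrite /= n0.
rewrite /= => /andP[dn dw]; case: eqP => [_|ne] /=; first by rewrite n0 IHw.
by rewrite dw andbT; lia.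
Qed.

(* Digits lie in [1, n], so two of them differ by less than n. *)
Lemma leq_value_tail n a b d e :
  d <= n -> 0 < e <= n -> e + n * a <= d + n * b -> a <= b.
Proof. by move=> dn en le; rewrite leqNgt; apply/negP => ba; nia. Qed.

(** Strings tried before that of G_i are thus no longer than it, which gives all trials a common
    time bound. *)
Lemma leq_size_value n u v :
  digits n u -> digits n v -> value n u <= value n v -> size u <= size v.
Proof.
elim: u v => [|d u IHu] [|e v] //= /andP[dn du]; first by lia.
case/andP=> en dv le; rewrite ltnS IHu //.
by apply: leq_value_tail le => //; case/andP: en.
Qed.

(** Ensures that a counter reaching the value of the string of G_i holds that very string. *)
Lemma value_inj n u v :
  digits n u -> digits n v -> value n u = value n v -> u = v.
Proof.
elim: u v => [|d u IHu] [|e v] //=; try by [move=> _ /andP[]; lia | move=> /andP[]; lia].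
move=> /andP[dn du] /andP[en dv] eqv.
have tE : value n u = value n v.
  apply/eqP; rewrite eqn_leq; apply/andP; split.
    by apply: (@leq_value_tail n _ _ e d) => //; lia.
  by apply: (@leq_value_tail n _ _ d e) => //; lia.
by rewrite (IHu v) //; congr (_ :: _); lia.
Qed.

(* [+ 2] rather than [+ 1] absorbs the geometric series in the induction. *)
Lemma value_bound n w : 1 < n -> digits n w -> value n w + 2 <= 2 * n ^ size w.
Proof.
move=> n1; elim: w => [|d w IHw] //= /andP[dn dw].
(* Since [d <= n], the left side is at most [n + n * (2 * n ^ size w - 2) + 2], and [n >= 2] absorbs
   the rest. *)
by have := IHw dw; rewrite expnS; nia.
Qed.

Lemma value_lt n w : 0 < n -> digits n w -> size w <= n ->
  value n w < 2 * n ^ size w.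
Proof.
(* For [n = 1] the value is the length, which [size w <= n] limits to 0 or 1. *)
case: n => [|[|n]] // _ dw sw; last by have := value_bound _ dw; lia.
by case: w dw sw => [|d [|e w]] //= /andP[]; lia.
Qed.

(** * Incrementing the stored numeral *)

(** With [behead], one formula covers both overwriting a digit and, for empty [u], appending one. *)
Lemma nth_update k x u i :
  nth 0 (nseq k 1 ++ x :: behead u) i =
  if i == k then x else nth 0 (nseq k 1 ++ u) i.
Proof.
rewrite !nth_cat size_nseq; case: (ltngtP i k) => [//|ki|->]; last by rewrite subnn.
by have -> : i - k = (i - k).-1.+1 by [lia]; rewrite /= nth_behead.
Qed.

Lemma cat_nseqS (T : Type) k (x : T) u : nseq k.+1 x ++ u = nseq k x ++ x :: u.
Proof. by elim: k => //= k ->. Qed.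

Lemma increment_runs s n w : 0 < n -> reg s 0 = n -> reg s 4 = 1 ->
  digits n w -> stores w s ->
  runs increment s (size w * 6 + 7) (stores (succ n w)).
Proof.
move=> n0 r0 r4 dw sw.
have -> : size w * 6 + 7 = 4 + (size w * 6).+1 + 2 by lia.
apply: runs_seq; apply: runs_seq; apply: runs_straight => //.
set body := Seq (Write 3 13 4) _.
have := @runs_while 12 body 5 (size w)
  (fun k s' => exists u,
    [/\ size u + k = size w, digits n u, succ n w = nseq k 1 ++ succ n u,
        stores (nseq k 1 ++ u) s' &
        [/\ reg s' 0 = n, reg s' 4 = 1, reg s' 13 = k, reg s' 7 = head 0 u
          & reg s' 12 = 1 - (n - head 0 u)]]).
set s0 := effect _ _ => /(_ s0) H.
apply: (runs_weaken (H _ _) (leqnn _)).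
(* An empty suffix reads 0, and [n > 0] then makes register 12 zero. Otherwise a nonzero register 12
   forces the digit to be [n]. *)
- move=> k s' [[|d u] [/= su du sE st [h0 h4 h13 h7 h12]]]; first by lia.
  case/andP: du => dn du nz; have dE : d = n by lia.
  split; first by lia.
  apply: runs_straight => //=.
  have stE i : (if i == k then 1 else arr s' 3 i) = nth 0 (nseq k.+1 1 ++ u) i.
    by rewrite cat_nseqS -[u]/(behead (d :: u)) nth_update st.
  exists u; split=> //=; first by lia.
  + by rewrite sE dE eqxx -cat_nseqS.
  + by move=> i; rewrite /= h13 h4 stE.
  + rewrite h13 h4 h0 stE addn1 nth_cat size_nseq ltnn subnn nth0.
    by split.
- exists w; split=> //=; rewrite ?addn0 // r0 r4 sw nth0; by split.
- move=> s' [z [k _ [u [_ du sE st [h0 h4 h13 h7 h12]]]]].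
  apply: runs_straight => //= i; rewrite /= h13 h7 h4 st addn1 sE -nth_update.
  congr (nth 0 (_ ++ _) i).
  by case: u {du sE st} h12 {h7} => [//|d u] /= h12; case: eqP => //; lia.
Qed.

(** * From memory contents to samples and subsets *)

Lemma nth_flatten_rows (T : Type) (x : T) n (ss : seq (seq T)) k j :
  all (fun r => size r == n) ss -> j < n ->
  nth x (flatten ss) (k * n + j) = nth x (nth [::] ss k) j.
Proof.
move=> sz jn; elim: ss k sz => [|r ss IH] [|k] /=; rewrite ?nth_nil //.
  by case/andP=> /eqP rn _; rewrite nth_cat rn jn.
case/andP=> /eqP rn sz; rewrite nth_cat rn ltnNge mulSn -addnA leq_addr /=.
by rewrite addKn IH.
Qed.

Lemma input_label kappa n m (ls : m.-tuple (labelling n)) ys (k : 'I_m) (j : 'I_n) :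
  arr (input kappa ls ys) 0 (k * n + j) = (tnth ls k j == phi).
Proof.
rewrite /= (@nth_flatten_rows _ 0 n) //; last first.
  by apply/allP=> _ /mapP[l _ ->]; rewrite size_map size_enum_ord.
rewrite (nth_map [ffun=> phi]) ?size_tuple // (nth_map j) ?size_enum_ord //.
by rewrite nth_ord_enum -tnth_nth.
Qed.

Lemma input_prediction kappa n m (ls : m.-tuple (labelling n)) ys (k : 'I_m) :
  arr (input kappa ls ys) 1 k = tnth ys k.
Proof. by rewrite /= (nth_map false) ?size_tuple // -tnth_nth. Qed.

Definition set_of (n : nat) (w : seq nat) : {set 'I_n} := [set j : 'I_n | j.+1 \in w].

Lemma row_okP kappa n m (ls : m.-tuple (labelling n)) Gi (w : seq nat) s (k : 'I_m) :
  (forall a, a < 2 -> forall i, arr s a i = arr (input kappa ls (oracle kappa ls Gi)) a i) ->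
  (forall j, j < n -> arr s 2 j = (j.+1 \in w)) ->
  row_ok kappa n s k =
  (all_but kappa (tnth ls k) (set_of n w) == all_but kappa (tnth ls k) Gi).
Proof.
move=> inp a2.
have -> : row_ok kappa n s k =
    (all_but kappa (tnth ls k) (set_of n w) == tnth (oracle kappa ls Gi) k).
  rewrite /row_ok inp // input_prediction /all_but ltnNge.
  have -> : row_count s n k = \sum_(j in set_of n w) (tnth ls k j == phi).
    rewrite /row_count big_mkord [RHS]big_mkcond /=; apply: eq_bigr => j _.
    rewrite inp // input_label a2 // inE.
    by case: (tnth ls k j == phi); case: (_ \in w).
  by case: (_ <= kappa); case: (tnth _ k).
by rewrite tnth_map.
Qed.

(** * The search and its running time *)

(** The invariant between trials. Array 2 and the scratch registers are left free because each trial
    rebuilds them. *)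
Record ready kappa n m (ls : m.-tuple (labelling n)) Gi (w : seq nat) (s : state) :
    Prop := Ready {
  ready_regs : [/\ reg s 0 = n, reg s 1 = m, reg s 2 = kappa, reg s 3 = 0 & reg s 4 = 1];
  ready_input : forall a, a < 2 ->
    forall i, arr s a i = arr (input kappa ls (oracle kappa ls Gi)) a i;
  ready_digits : digits n w;
  ready_stores : stores w s }.

Lemma ready_frame kappa n m (ls : m.-tuple (labelling n)) Gi w w' p s s' :
  ready kappa ls Gi w s -> frame p s s' ->
  all (fun x => keeps_reg x p) (iota 0 5) -> all (fun a => keeps_arr a p) (iota 0 2) ->
  digits n w' -> stores w' s' -> ready kappa ls Gi w' s'.
Proof.
move=> [[h0 h1 h2 h3 h4] inp _ _] [fr fa] /= /and5P[k0 k1 k2 k3 /andP[k4 _]].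
move=> /and3P[l0 l1 _] dw st; split=> //; first by rewrite !fr.
by move=> [|[|]] // _ i; rewrite fa // inp.
Qed.

Definition tried kappa n m (ls : m.-tuple (labelling n)) Gi w s : Prop :=
  [/\ ready kappa ls Gi w s,
      forall j : 'I_n, arr s 2 j = (j \in set_of n w) &
      reg s 11 = 0 <-> feasible kappa ls Gi (set_of n w)].

Lemma trial_runs kappa n m (ls : m.-tuple (labelling n)) Gi w s :
  ready kappa ls Gi w s ->
  runs trial s (n * 3 + 2 + (size w * 5 + 3 + (m * (n * 9 + 12) + 4)))
    (tried kappa ls Gi w).
Proof.
move=> rdy; have [[h0 _ _ h3 h4] _ dw st] := rdy.
apply: runs_seq; apply: runs_weaken (runs_frame (clear_runs h0 h3 h4)) (leqnn _) _.
move=> s1 [z f1]; have st1 : stores w s1 by move=> i; rewrite f1.2.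
have {}rdy := ready_frame rdy f1 isT isT dw st1; have [[_ _ _ _ g4] _ _ _] := rdy.
apply: runs_seq; apply: runs_weaken (runs_frame (mark_runs g4 dw st1 z)) (leqnn _) _.
move=> s2 [a2 f2]; have st2 : stores w s2 by move=> i; rewrite f2.2.
have {}rdy := ready_frame rdy f2 isT isT dw st2.
have [[e0 e1 e2 e3 e4] inp _ _] := rdy.
apply: runs_weaken (runs_frame (evaluate_runs e0 e1 e2 e3 e4)) (leqnn _) _.
move=> s3 [ok f3]; have st3 : stores w s3 by move=> i; rewrite f3.2.
split; first exact: ready_frame rdy f3 isT isT dw st3.
  by move=> j; rewrite f3.2 // a2 // inE.
split=> [/eqP|feas].
  rewrite ok => /allP oks k; have := row_okP k inp a2.
  by rewrite oks ?mem_iota ?ltn_ord // => /esym/eqP.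
apply/eqP; rewrite ok; apply/allP => k; rewrite mem_iota /= => km.
by rewrite (row_okP (Ordinal km) inp a2) feas.
Qed.

Definition string_of (n : nat) (F : {set 'I_n}) : seq nat :=
  [seq (val j).+1 | j <- enum F].

Lemma digits_string_of n (F : {set 'I_n}) : digits n (string_of F).
Proof. by apply/allP => _ /mapP[j _ ->] /=. Qed.

Lemma string_ofK n (F : {set 'I_n}) : set_of n (string_of F) = F.
Proof.
apply/setP=> j; rewrite inE -[j.+1]/((fun i : 'I_n => (val i).+1) j) mem_map.
  by rewrite mem_enum.
by move=> i1 i2 [] /val_inj.
Qed.

Lemma size_string_of n (F : {set 'I_n}) : size (string_of F) = #|F|.
Proof. by rewrite size_map -cardE. Qed.

Lemma finder_runs kappa n m (ls : m.-tuple (labelling n)) Gi :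
  runs finder (input kappa ls (oracle kappa ls Gi))
    ((value n (string_of Gi)).+1 * (14 * n + m * (n * 9 + 12) + 19))
    (fun s => exists2 F : {set 'I_n},
       feasible kappa ls Gi F & forall j : 'I_n, arr s 2 j = (j \in F)).
Proof.
set V := value _ _; set Tt := n * 3 + 2 + (n * 5 + 3 + (m * (n * 9 + 12) + 4)).
have small w : digits n w -> value n w <= V -> size w <= n.
  move=> dw wV; apply: leq_trans (leq_size_value dw (digits_string_of Gi) wV) _.
  by rewrite size_string_of -[X in _ <= X]card_ord max_card.
have try w s : ready kappa ls Gi w s -> value n w <= V ->
    runs trial s Tt (tried kappa ls Gi w).
  move=> rdy wV; apply: runs_weaken (trial_runs rdy) _ _ => //.
  by have := small w (ready_digits rdy) wV; rewrite /Tt; lia.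
suff : runs finder (input kappa ls (oracle kappa ls Gi))
    (1 + (Tt + (V * (n * 6 + 7 + Tt).+1).+1))
    (fun s => exists2 F : {set 'I_n},
       feasible kappa ls Gi F & forall j : 'I_n, arr s 2 j = (j \in F)).
  by move=> r; apply: runs_weaken r _ _ => //; rewrite /Tt; nia.
apply: runs_seq; apply: runs_straight => //; apply: runs_seq.
apply: runs_weaken (try [::] _ _ _) (leqnn _) _ => // s ts.
have := @runs_while 11 (Seq increment trial) (n * 6 + 7 + Tt) V
  (fun k s' => k <= V /\ exists2 w, value n w = k & tried kappa ls Gi w s').
move=> /(_ s) H; apply: runs_weaken (H _ _) (leqnn _) _.
- move=> k s' [kV [w wk [rdy a2 fe]]] nz.
  have dw := ready_digits rdy.
  (* At [k = V] the string would be that of G_i, which is feasible, so register 11 would be zero. *)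
  have kltV : k < V.
    rewrite ltn_neqAle kV andbT -wk; apply: contra nz => /eqP.
    move=> /(value_inj dw (digits_string_of Gi)) wE.
    by apply/eqP/fe; rewrite wE string_ofK.
  (* If [n = 0], then [V = 0] and no increment is ever reached. *)
  have n0 : 0 < n.
    have [z|//] := posnP n; have := small _ (digits_string_of Gi) (leqnn _).
    by rewrite [X in _ <= X]z leqn0 => /nilP wG; move: kltV; rewrite /V wG.
  split=> //; apply: runs_seq.
  have [[h0 _ _ _ h4] _ _ st] := rdy.
  apply: runs_weaken (runs_frame (increment_runs n0 h0 h4 dw st)) _ _.
    by have := small w dw; rewrite wk => /(_ kV); lia.
  move=> s1 [st1 f1].
  have rdy1 := ready_frame rdy f1 isT isT (digits_succ n0 dw) st1.
  have sV : value n (succ n w) <= V by rewrite value_succ wk.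
  apply: runs_weaken (try _ _ rdy1 sV) (leqnn _) _ => s2 t2.
  by split=> //; exists (succ n w); rewrite // value_succ wk.
- by split=> //; exists [::].
- move=> s' [z [k _ [_ [w _ [_ a2 fe]]]]].
  by exists (set_of n w); first exact/fe.
Qed.

Theorem theorem4 :
  exists A : program,
    (forall kappa n : nat, CHF kappa n A) /\
    exists C : nat,
      forall (kappa n m : nat) (G : network n) (ls : m.-tuple (labelling n)),
        0 < n -> 0 < m ->
        exists (t : nat) (F : {set 'I_n}),
          [/\ outputs_in A kappa ls (oracle kappa ls (influencers G)) t F,
              feasible kappa ls (influencers G) F
            & t <= C * (m * n ^ (#|influencers G| + 1))].
Proof.
exists finder; split=> [kappa n m Gi ls _|].
  have [t [s [E _ [F fF a2]]]] := finder_runs kappa ls Gi.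
  by exists t, F; split=> //; exists s.
(* [108 = 2 * 54]: fewer than [2 * n ^ #|Gi|] increments precede success, and
   [54 = 14 + 9 + 12 + 19] bounds a trial since [m] and [n] are positive. *)
exists 108 => kappa n m G ls n0 m0; set Gi := influencers G.
have [t [s [E tT [F fF a2]]]] := finder_runs kappa ls Gi.
exists t, F; split=> //; first by exists s.
apply: leq_trans tT _.
have sG : size (string_of Gi) <= n.
  by rewrite size_string_of -[X in _ <= X]card_ord max_card.
have := value_lt n0 (digits_string_of Gi) sG; rewrite size_string_of => vlt.
have trial_le : 14 * n + m * (n * 9 + 12) + 19 <= 54 * (m * n) by nia.
apply: leq_trans (leq_mul vlt trial_le) _.
by rewrite addn1 expnS; lia.
Qed.
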